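(* Let $N\ge 2$ and let $f(\theta)=\sum_{n=0}^N a_n\cos(n\theta)$ be a non-negative trigonometric polynomial of degree $N$, i.e. the $a_n$ are real, $a_0>0$, $a_N\neq 0$, and $f(\theta)\ge 0$ for all real $\theta$. Suppose that (I) $a_1>0$, and (II) $\sum_{n=0}^N |a_n|\le 2a_1$. Then $$\frac{a_0}{a_1}\ge\frac34 .$$ *)

(* Defs.v *)
From mathcomp Require Export all_boot all_order all_algebra.
From mathcomp Require Export reals trigo.
Set Implicit Arguments.
Unset Strict Implicit.
Unset Printing Implicit Defensive.
Import GRing.Theory.
Local Open Scope ring_scope.

(* Only the coefficients a 0, ..., a N matter. *)
Definition cosine_poly (R : realType) (N : nat) (a : nat -> R) (theta : R) : R :=
  \sum_(0 <= n < N.+1) a n * cos (n%:R * theta).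

(* Main.v *)
Require Import Defs.
From mathcomp Require Import all_boot all_order all_algebra.
From mathcomp Require Import reals trigo.
From mathcomp Require Import ring lra.
Import Order.TTheory GRing.Theory Num.Theory.
Local Open Scope ring_scope.

(* Evaluating at [theta = pi], non-negativity and (II) force
   [(-1)^n a_n = |a_n|] for [n >= 2] and [f pi = 0]. So [pi] is a minimum of [f],
   and [f'' pi >= 0] would give [4 S <= a_1] for the sum [S] of the [|a_n|],
   [n >= 2], while [a_0 = a_1 - S]. Instead of differentiating, compare
   [f (pi - t) >= 0] with [cos (n t) <= cos (2 t)], valid for [2 <= n <= N] and
   [N t <= pi]: it gives [2 S (1 + cos t) <= a_1], and [t] is let tend to [0]. *)

Lemma cosBnatpi (R : realType) (n : nat) (t : R) :
  cos (n%:R * (pi - t)) = (-1) ^+ n * cos (n%:R * t).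
Proof.
have -> : n%:R * (pi - t) = - (n%:R * t) + pi *+ n by rewrite -mulr_natl; ring.
by rewrite (alternatingn (@cosDpi R)) cosN.
Qed.

Lemma cosine_poly_split (R : realType) (N : nat) (a : nat -> R) (t : R) :
  (2 <= N)%N -> cosine_poly N a (pi - t) =
  a 0%N - a 1%N * cos t
  + \sum_(2 <= n < N.+1) (-1) ^+ n * a n * cos (n%:R * t).
Proof.
move=> hN; rewrite /cosine_poly big_ltn // big_ltn; last by rewrite ltnS ltnW.
rewrite addrA; congr (_ + _).
  by rewrite !cosBnatpi !mul0r cos0 expr1 !mul1r; ring.
by apply: eq_bigr => n _; rewrite cosBnatpi; ring.
Qed.

(** Both angles lie in [[0, pi]], where cosine decreases. *)
Lemma cos_natmul_le_cos2 (R : realType) (n : nat) (t : R) :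
  (2 <= n)%N -> 0 <= t -> n%:R * t <= pi -> cos (n%:R * t) <= cos (2 * t).
Proof.
move=> hn t0 ntpi; have le2 : 2 * t <= n%:R * t by rewrite ler_wpM2r // ler_nat.
rewrite leNgt ltr_cos ?in_itv /= -?leNgt //.
  by rewrite mulr_ge0.
by rewrite mulr_ge0 //= (le_trans le2).
Qed.

Theorem theorem2 (R : realType) (N : nat) (a : nat -> R)
  (hN : (2 <= N)%N)
  (ha0 : 0 < a 0%N)
  (haN : a N != 0)
  (hf : forall theta : R, 0 <= cosine_poly N a theta)
  (hI : 0 < a 1%N)
  (hII : \sum_(0 <= n < N.+1) `|a n| <= 2 * a 1%N) :
  3 / 4 <= a 0%N / a 1%N.
Proof.
pose S := \sum_(2 <= n < N.+1) `|a n|.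
have S0 : 0 <= S by rewrite sumr_ge0.
have sum_le : a 0%N + S <= a 1%N.
  move: hII; rewrite big_ltn // big_ltn; last by rewrite ltnS ltnW.
  rewrite -/S !gtr0_norm //; lra.
have le_norm n : (-1) ^+ n * a n <= `|a n|.
  by rewrite (le_trans (ler_norm _)) // normrM normr_sign mul1r.
have sum_ge : a 1%N - a 0%N <= \sum_(2 <= n < N.+1) (-1) ^+ n * a n.
  have := hf (pi - 0); rewrite cosine_poly_split // cos0.
  under eq_bigr do rewrite mulr0 cos0 mulr1.
  by lra.
(* The gaps between the two sides are non-negative, and by [sum_le] and [sum_ge] their sum is at
   most [0], so each one vanishes. *)
have signs n : (2 <= n < N.+1)%N -> (-1) ^+ n * a n = `|a n|.
  move=> hn; apply/eqP; rewrite eq_sym -subr_eq0.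
  have /eqP : \sum_(2 <= k < N.+1) (`|a k| - (-1) ^+ k * a k) = 0.
    apply/eqP; rewrite eq_le sumr_ge0 ?andbT.
      by rewrite sumrB -/S; lra.
    by move=> k _; rewrite subr_ge0.
  rewrite psumr_eq0 => [/allP/(_ n)|k _]; last by rewrite subr_ge0.
  by rewrite mem_index_iota => /(_ hn).
have sumE : S = a 1%N - a 0%N.
  apply/eqP; rewrite eq_le; apply/andP; split; first by lra.
  by move: sum_ge; rewrite (eq_big_nat _ _ signs).
have N0 : 0 < N%:R :> R by rewrite ltr0n (leq_trans _ hN).
have piN : pi / N%:R \in `[(0 : R), pi].
  rewrite in_itv /= divr_ge0 ?pi_ge0 ?(ltW N0) //= ler_pdivrMr //.
  by rewrite ler_peMr ?pi_ge0 // ler1n ltnW.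
(* Here [c] stands for [cos t]: the lower bound on [c] encodes [N t <= pi], and [c < 1] allows
   division by [1 - c]. *)
have near1 c : cos (pi / N%:R) <= c -> c < 1 -> 2 * S * (1 + c) <= a 1%N.
  move=> c_ge c1; have cN1 : -1 <= c := le_trans (cos_geN1 _) c_ge.
  have c_itv : -1 <= c <= 1 by rewrite cN1 ltW.
  have t0 := acos_ge0 c_itv; have cosK := acosK c_itv.
  set t := acos c in t0 cosK.
  have Nt : N%:R * t <= pi.
    rewrite mulrC -ler_pdivlMr // leNgt -ltr_cos //.
      by rewrite cosK -leNgt.
    by rewrite in_itv /= t0 acos_lepi.
  have : \sum_(2 <= n < N.+1) (-1) ^+ n * a n * cos (n%:R * t)
         <= S * cos (2 * t).
    rewrite /S mulr_suml ler_sum_nat // => n hn; rewrite signs //.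
    have /andP[n2 nN] := hn; rewrite ler_wpM2l // cos_natmul_le_cos2 //.
    by rewrite (le_trans _ Nt) // ler_wpM2r // ler_nat.
  have := hf (pi - t); rewrite cosine_poly_split // cosK.
  rewrite [2 * t]mulr_natl cos_mulr2n cosK mulr2n => h1 h2.
  (* With [a_0 = a_1 - S], [h1] and [h2] combine to [2 S (1 - c^2) <= a_1 (1 - c)]. *)
  rewrite -(ler_pM2r (_ : 0 < 1 - c)) ?subr_gt0 //.
  nra.
rewrite ler_pdivlMr // leNgt; apply/negP => a0_lt.
have S4 : a 1%N < 4 * S by lra.
have Sgt0 : 0 < S by lra.
(* Any [c] strictly between [m] and [1] meets the conditions of [near1] but violates its conclusion;
   the midpoint [(1 + m) / 2] replaces the limit [t -> 0]. *)
pose m := Num.max (cos (pi / N%:R)) (a 1%N / (2 * S) - 1).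
have m_lt1 : m < 1.
  rewrite /m gt_max; apply/andP; split; last first.
    by rewrite ltrBlDr ltr_pdivrMr; lra.
  rewrite -[ltRHS]cos0 ltr_cos ?divr_gt0 ?pi_gt0 //.
  by rewrite in_itv /= lexx pi_ge0.
have [m_ge1 m_ge2] : cos (pi / N%:R) <= m /\ a 1%N / (2 * S) - 1 <= m.
  by split; rewrite /m le_max lexx ?orbT.
have : a 1%N / (2 * S) < 1 + (1 + m) / 2 by lra.
rewrite ltr_pdivrMr ?mulr_gt0 // mulrC ltNge => /negP; apply.
by apply: near1; lra.
Qed.
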